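(* Let $k$ be a field of characteristic two, $P=k[x,y,z,w]$, and $$\mathfrak A=\frac{k[x,y,z,w]}{(xy,\,xz,\,xw,\,y^2,\,z^2,\,w^2,\,x^3+yzw)}.$$ Let $$K_1=\begin{bmatrix}y^2&z^2&xy&xz&xw\end{bmatrix},\qquad K_2=\begin{bmatrix}z^2&0&x&0&0&0\\ y^2&x&0&0&0&0\\ 0&0&y&0&w&z\\ 0&z&0&w&0&y\\ 0&0&0&z&y&0\end{bmatrix},\qquad K_3=\begin{bmatrix}x&0\\ y^2&0\\ z^2&0\\ 0&y\\ 0&z\\ yz&w\end{bmatrix},$$ $$L_0=\begin{bmatrix}w^2&x^3+yzw\end{bmatrix},\qquad L_1=\begin{bmatrix}0&w^2&0&zw&0&0\\ 0&0&w^2&0&yw&0\\ 0&0&0&x^2&0&0\\ 0&0&0&0&x^2&0\\ w&0&0&0&0&x^2\end{bmatrix}.$$ Then the following diagram is a map of complexes, from the complex $$0\to P\xrightarrow{K_1^{T}}P^5\xrightarrow{K_2^{T}}P^6\xrightarrow{K_3^{T}}P^2$$ to the complex $$0\to P^2\xrightarrow{K_3}P^6\xrightarrow{K_2}P^5\xrightarrow{K_1}P,$$ with vertical maps (from left to right) $L_0^{T}:P\to P^2$, $L_1^{T}:P^5\to P^6$, $L_1:P^6\to P^5$, $L_0:P^2\to P$, and the mapping cone of this map of complexes is the minimal homogeneous resolution of $\mathfrak A$ by free $P$-modules.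
   Context: $P$ is standard graded; $X^{T}$ denotes the transpose of a matrix $X$; matrices act on column vectors. *)

(* Defs.v *)
From HB Require Import structures.
From mathcomp Require Import all_boot all_order all_algebra.
From mathcomp Require Import generic_quotient ring_quotient.
From mathcomp Require Import boolp.
From mathcomp Require Import mpoly.

Set Implicit Arguments.
Unset Strict Implicit.
Unset Printing Implicit Defensive.

Import GRing.Theory.
Local Open Scope ring_scope.
Local Open Scope quotient_scope.

(* Complexes of finite free R-modules  ... -> R^(rk 1) -> R^(rk 0) -> 0,
   sitting in homological degrees >= 0. Elements of R^n are column vectors and
   [diff i] is the matrix of the map R^(rk i.+1) -> R^(rk i). *)
Record free_seq (R : comNzRingType) := FreeSeq {
  rk : nat -> nat;
  diff : forall i, 'M[R]_(rk i, rk i.+1)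
}.

Definition is_complex (R : comNzRingType) (C : free_seq R) : Prop :=
  forall i, diff C i *m diff C i.+1 = 0.

Definition is_complex_map (R : comNzRingType) (C D : free_seq R)
    (f : forall i, 'M[R]_(rk D i, rk C i)) : Prop :=
  forall i, f i *m diff C i = diff D i *m f i.+1.

(* The complex C[-1]: C_(i-1) in degree i, without the sign. *)
Definition shift_rk (R : comNzRingType) (C : free_seq R) (i : nat) : nat :=
  if i is j.+1 then rk C j else 0%N.

Definition shift_diff (R : comNzRingType) (C : free_seq R) (i : nat) :
    'M[R]_(shift_rk C i, shift_rk C i.+1) :=
  match i return 'M[R]_(shift_rk C i, shift_rk C i.+1) with
  | 0 => 0
  | j.+1 => diff C j
  end.

(* cone_i = C_(i-1) (+) D_i with differential (c, d) |-> (- dC c, f c + dD d). *)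
Definition mapping_cone (R : comNzRingType) (C D : free_seq R)
    (f : forall i, 'M[R]_(rk D i, rk C i)) : free_seq R :=
  @FreeSeq R (fun i => shift_rk C i + rk D i)%N
    (fun i => block_mx (- shift_diff C i) 0 (f i) (diff D i)).

(* The ideal generated by a finite sequence. *)
Definition ideal_gen (R : comNzRingType) (gs : seq R) : {pred R} :=
  fun p => `[< exists c : 'I_(size gs) -> R,
                 p = \sum_(i < size gs) c i * gs`_i >].

Lemma ideal_genP (R : comNzRingType) (gs : seq R) (p : R) :
  reflect (exists c : 'I_(size gs) -> R, p = \sum_(i < size gs) c i * gs`_i)
          (p \in ideal_gen gs).
Proof. exact: asboolP. Qed.

Lemma ideal_gen_closed (R : comNzRingType) (gs : seq R) :
  1 \notin ideal_gen gs -> idealr_closed (ideal_gen gs).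
Proof.
move=> n1; split=> //.
  by apply/ideal_genP; exists (fun=> 0); rewrite big1 // => i _; rewrite mul0r.
move=> a u v /ideal_genP[c ->] /ideal_genP[d ->].
apply/ideal_genP; exists (fun i => a * c i + d i).
rewrite mulr_sumr -big_split /=; apply: eq_bigr => i _.
by rewrite mulrDl mulrA.
Qed.

(* Homogeneous elements of integer degree for the standard grading. *)
Definition homogz (n : nat) (k : fieldType) (d : int) (p : {mpoly k[n]}) : Prop :=
  match d with
  | Posz e => p \is e.-homog
  | Negz _ => p = 0
  end.

(* Homogeneous elements of degree d of the graded free module
   P(- b 0) (+) ... (+) P(- b (r-1)). *)
Definition free_homog (n : nat) (k : fieldType) (r : nat) (b : 'I_r -> int)
    (d : int) (v : 'cV[{mpoly k[n]}]_r) : Prop :=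
  forall j, homogz (d - b j) (v j 0).

Definition irrelevant_ideal (n : nat) (k : fieldType) : {pred {mpoly k[n]}} :=
  ideal_gen [seq 'X_i | i <- enum 'I_n].

(* [Mdeg d] is the set of homogeneous elements of degree d of M. The [int]s
   [b i j] are the degrees of the basis elements of F_i, and [aug] is the
   augmentation F_0 -> M. *)
Definition homogeneous_resolution (n : nat) (k : fieldType)
    (M : lmodType {mpoly k[n]}) (Mdeg : int -> M -> Prop)
    (F : free_seq {mpoly k[n]}) : Prop :=
  exists (b : forall i, 'I_(rk F i) -> int)
         (aug : {linear 'cV[{mpoly k[n]}]_(rk F 0) -> M}),
    [/\ is_complex F,
        forall i (v : 'cV_(rk F i.+1)),
          diff F i *m v = 0 -> exists u, v = diff F i.+1 *m u,
        forall a : M, exists v, aug v = a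
      & forall v, aug v = 0 <-> exists u, v = diff F 0 *m u] /\
    [/\ forall i d (v : 'cV_(rk F i.+1)),
          free_homog (b i.+1) d v -> free_homog (b i) d (diff F i *m v)
      & forall d v, free_homog (b 0) d v -> Mdeg d (aug v)].

(* The image of F_(i+1) lies in m F_i, where m is the irrelevant ideal. *)
Definition minimal_complex (n : nat) (k : fieldType)
    (F : free_seq {mpoly k[n]}) : Prop :=
  forall i (v : 'cV_(rk F i.+1)) j,
    (diff F i *m v) j 0 \in @irrelevant_ideal n k.

Definition minimal_homogeneous_resolution (n : nat) (k : fieldType)
    (M : lmodType {mpoly k[n]}) (Mdeg : int -> M -> Prop)
    (F : free_seq {mpoly k[n]}) : Prop :=
  homogeneous_resolution Mdeg F /\ minimal_complex F.

Section Data.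
Variable k : fieldType.

Local Notation x := ('X_(@Ordinal 4 0 isT) : {mpoly k[4]}).
Local Notation y := ('X_(@Ordinal 4 1 isT) : {mpoly k[4]}).
Local Notation z := ('X_(@Ordinal 4 2 isT) : {mpoly k[4]}).
Local Notation w := ('X_(@Ordinal 4 3 isT) : {mpoly k[4]}).

Definition idealA_gens : seq {mpoly k[4]} :=
  [:: x * y; x * z; x * w; y ^+ 2; z ^+ 2; w ^+ 2; x ^+ 3 + y * z * w].

Definition idealA : {pred {mpoly k[4]}} := ideal_gen idealA_gens.

Lemma idealA_closed : idealr_closed idealA.
Proof.
apply: ideal_gen_closed; apply/negP => /ideal_genP[c].
move=> /(congr1 (meval (fun=> 0))); rewrite rmorph1 rmorph_sum /=.
rewrite big1 => [/eqP|]; first by rewrite oner_eq0.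
move=> i _; rewrite rmorphM /=.
suff -> : meval (fun=> 0) idealA_gens`_i = 0 by rewrite mulr0.
case: i => -[|[|[|[|[|[|[|//]]]]]]] _ /=;
  by rewrite ?(rmorphD, rmorphM, rmorphXn) /= !mevalXU ?(mulr0, mul0r, expr0n, addr0).
Qed.

HB.instance Definition _ := isIdealr.Build {mpoly k[4]} idealA idealA_closed.

Definition algA := {ideal_quot idealA}.
HB.instance Definition _ := GRing.ComNzRing.on algA.

Definition piA : {mpoly k[4]} -> algA := \pi_({ideal_quot idealA}).

(* The P-module structure of the quotient P / I. *)
Definition scaleA (p : {mpoly k[4]}) (a : algA) : algA := piA p * a.

Lemma scaleA_mul p q a : scaleA p (scaleA q a) = scaleA (p * q) a.
Proof. by rewrite /scaleA /piA rmorphM mulrA. Qed.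
Lemma scaleA_1 : left_id 1 scaleA.
Proof. by move=> a; rewrite /scaleA /piA rmorph1 mul1r. Qed.
Lemma scaleA_addr : right_distributive scaleA +%R.
Proof. by move=> p a b; rewrite /scaleA mulrDr. Qed.
Lemma scaleA_addl a : {morph scaleA^~ a : p q / p + q}.
Proof. by move=> p q; rewrite /scaleA /piA rmorphD mulrDl. Qed.

HB.instance Definition _ := GRing.Zmodule_isLmodule.Build {mpoly k[4]} algA
  scaleA_mul scaleA_1 scaleA_addr scaleA_addl.

(* The grading of the quotient induced by that of P. *)
Definition degA (d : int) (a : algA) : Prop :=
  exists2 p, homogz d p & a = piA p.

Definition mx_of_rows (m n : nat) (s : seq (seq {mpoly k[4]})) :
    'M[{mpoly k[4]}]_(m, n) :=
  \matrix_(i < m, j < n) (nth [::] s i)`_j.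

Definition K1 : 'M[{mpoly k[4]}]_(1, 5) := mx_of_rows 1 5
  [:: [:: y ^+ 2; z ^+ 2; x * y; x * z; x * w]].

Definition K2 : 'M[{mpoly k[4]}]_(5, 6) := mx_of_rows 5 6
  [:: [:: z ^+ 2; 0; x; 0; 0; 0];
      [:: y ^+ 2; x; 0; 0; 0; 0];
      [:: 0;      0; y; 0; w; z];
      [:: 0;      z; 0; w; 0; y];
      [:: 0;      0; 0; z; y; 0]].

Definition K3 : 'M[{mpoly k[4]}]_(6, 2) := mx_of_rows 6 2
  [:: [:: x;      0];
      [:: y ^+ 2; 0];
      [:: z ^+ 2; 0];
      [:: 0;      y];
      [:: 0;      z];
      [:: y * z;  w]].

Definition L0 : 'M[{mpoly k[4]}]_(1, 2) := mx_of_rows 1 2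
  [:: [:: w ^+ 2; x ^+ 3 + y * z * w]].

Definition L1 : 'M[{mpoly k[4]}]_(5, 6) := mx_of_rows 5 6
  [:: [:: 0; w ^+ 2; 0;      z * w;  0;      0];
      [:: 0; 0;      w ^+ 2; 0;      y * w;  0];
      [:: 0; 0;      0;      x ^+ 2; 0;      0];
      [:: 0; 0;      0;      0;      x ^+ 2; 0];
      [:: w; 0;      0;      0;      0;      x ^+ 2]].

(* 0 -> P^2 -> P^6 -> P^5 -> P, the last P in degree 0. *)
Definition botC : free_seq {mpoly k[4]} :=
  @FreeSeq {mpoly k[4]} (nth 0%N [:: 1; 5; 6; 2]%N)
    (fun i => match i return
        'M_(nth 0%N [:: 1; 5; 6; 2]%N i, nth 0%N [:: 1; 5; 6; 2]%N i.+1) with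
      | 0 => K1 | 1 => K2 | 2 => K3 | _ => 0
      end).

(* 0 -> P -> P^5 -> P^6 -> P^2, the last P^2 in degree 0. *)
Definition topC : free_seq {mpoly k[4]} :=
  @FreeSeq {mpoly k[4]} (nth 0%N [:: 2; 6; 5; 1]%N)
    (fun i => match i return
        'M_(nth 0%N [:: 2; 6; 5; 1]%N i, nth 0%N [:: 2; 6; 5; 1]%N i.+1) with
      | 0 => K3^T | 1 => K2^T | 2 => K1^T | _ => 0
      end).

Definition vertL (i : nat) : 'M[{mpoly k[4]}]_(rk botC i, rk topC i) :=
  match i return 'M_(rk botC i, rk topC i) with
  | 0 => L0 | 1 => L1 | 2 => L1^T | 3 => L0^T | _ => 0
  end.

End Data.

(* Main.v *)
(** The complex of the [K_i] resolves [k[x,y,z,w]/J] with [J = (y^2, z^2, xy, xz, xw)],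
    and its transpose is exact in positive degrees as well. The long exact sequence of
    the cone then leaves one thing to check: the map induced by [L_0] on [H_0] is
    injective, that is [L_0 c \in J] forces [c \in im K_3^T]. As the cokernel of the
    latter map is the quotient of [P] by [J + (w^2, x^3 + yzw)], the cone resolves it.
    All the kernels are computed by hand from two facts: a monomial ideal contains a
    polynomial iff it contains all its monomials, and the Koszul relations are the
    only relations between two or three pure powers of distinct variables. *)

Require Import Defs.
From HB Require Import structures.
From mathcomp Require Import all_boot all_order all_algebra.
From mathcomp Require Import mpoly.
From mathcomp Require Import ring_quotient ring.
Import GRing.Theory.
Local Open Scope ring_scope.

Set Implicit Arguments.
Unset Strict Implicit.
Unset Printing Implicit Defensive.

(** * Exactness of mapping cones *)

Section ConeExactness.
Variable R : comNzRingType.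
Implicit Types C D : free_seq R.

(* Exactness in positive degrees only. *)
Definition acyclic C := forall i (v : 'cV[R]_(rk C i.+1)),
  diff C i *m v = 0 -> exists u, v = diff C i.+1 *m u.

Lemma mapping_cone_complex C D (f : forall i, 'M[R]_(rk D i, rk C i)) :
  is_complex C -> is_complex D -> is_complex_map f ->
  is_complex (mapping_cone f).
Proof.
move=> cC cD fm i.
rewrite /= mulmx_block !mul0mx !mulmx0 !addr0 !add0r mulmxN mulNmx opprK.
apply: etrans (block_mx0 _ _ _ _ _); congr block_mx.
- by case: i => [|i] /=; [rewrite mul0mx | exact: cC].
- by rewrite mulmxN; apply/eqP; rewrite addr_eq0 eqr_opp; apply/eqP/fm.
- exact: cD.
Qed.

(** The last hypothesis says that the map induced by [f] from H_0 of [C] to H_0 of [D] is injective.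
    For a cycle (c, d) of the cone, c bounds in [C]; correcting by that boundary leaves a cycle of
    [D], which bounds in turn. *)
Lemma mapping_cone_acyclic C D (f : forall i, 'M[R]_(rk D i, rk C i)) :
  is_complex_map f -> acyclic C -> acyclic D ->
  (forall (c : 'cV_(rk C 0)) (u : 'cV_(rk D 1)),
     f 0%N *m c = diff D 0 *m u -> exists v, c = diff C 0 *m v) ->
  acyclic (mapping_cone f).
Proof.
move=> fm eC eD inj0 i v.
rewrite /= -[v]vsubmxK mul_block_col mul0mx addr0.
set c : 'cV_(rk C i) := usubmx v; set d : 'cV_(rk D i.+1) := dsubmx v => e.
have [e1 e2] : shift_diff C i *m c = 0 /\ f i *m c + diff D i *m d = 0.
  move: e; rewrite -[0]vsubmxK !linear0 => /eq_col_mx[e1 e2]; split=> //.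
  by apply/eqP; rewrite -oppr_eq0 -mulNmx e1.
have [u cu] : exists u, c = diff C i *m u.
  (* For i = 0 the equation [e1] is empty, since the target of [shift_diff] has rank 0. But [e2]
     puts the image of [c] under [f] into the image of [diff D 0], so injectivity on H_0 applies. *)
  case: i v @c @d e e1 e2 => [|i] v c d _ e1 e2; last exact: eC.
  apply: (inj0 c (- d)).
  by apply/eqP; rewrite mulmxN -addr_eq0 e2.
have [s ds] : exists s, d + f i.+1 *m u = diff D i.+1 *m s.
  by apply: eD; rewrite mulmxDr mulmxA -fm -mulmxA -cu addrC.
(* The minus sign compensates the negated differential of [C] in the cone. *)
exists (col_mx (- u) s); rewrite mul_block_col mul0mx addr0.
by rewrite mulNmx !mulmxN opprK -ds addrC addrK -cu.
Qed.

End ConeExactness.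

(** * Monomial ideals and relations between pure powers *)

Lemma ideal_gen_nil (R : comNzRingType) (p : R) : p \in ideal_gen [::] -> p = 0.
Proof. by move=> /ideal_genP[c ->]; rewrite big_ord0. Qed.

(** Peels off one generator, so that membership in an explicit ideal becomes a successive choice of
    coefficients, ended by [ideal_gen_nil]. *)
Lemma ideal_gen_cons (R : comNzRingType) (g : R) (gs : seq R) (p : R) :
  p \in ideal_gen (g :: gs) <-> exists c, p - c * g \in ideal_gen gs.
Proof.
split=> [/ideal_genP[c ->]|[c /ideal_genP[d e]]].
  exists (c ord0); apply/ideal_genP; exists (fun i => c (lift ord0 i)).
  by rewrite big_ord_recl /= addrC addKr.
apply/ideal_genP; exists (fun i => if unlift ord0 i is Some j then d j else c).
rewrite big_ord_recl unlift_none /= -(subrK (c * g) p) e addrC; congr (_ + _).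
by apply: eq_bigr => i _; rewrite liftK.
Qed.

Section MonomialIdeals.
Variables (n : nat) (k : idomainType).
Implicit Types (p q r : {mpoly k[n]}) (g h m : 'X_{1..n}) (gs : seq 'X_{1..n}).

(** Induction on the generators: the terms of [p] divisible by the first one, [g], are gathered into
    a multiple of ['X_[g]]; each remaining term is divisible by a later generator. *)
Lemma monomial_idealP gs p :
  p \in ideal_gen [seq 'X_[g] | g <- gs] <->
  {in msupp p, forall m, has (fun g => (g <= m)%MM) gs}.
Proof.
elim: gs p => [|g gs IHgs] p; split.
- by move/ideal_gen_nil => ->; rewrite msupp0.
- case: (eqVneq p 0) => [-> _|]; first by apply/ideal_genP; exists (fun=> 0); rewrite big_ord0.
  by rewrite -msupp_eq0; case: (msupp p) => // m ms _ /(_ m (mem_head _ _)).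
- move=> /ideal_gen_cons[c /IHgs pgs] m mp /=; case: (boolP (g <= m)%MM) => //= ngm.
  apply: pgs; rewrite mcoeff_msupp mcoeffB (memN_msupp_eq0 (p := c * _)) ?subr0 -?mcoeff_msupp //.
  rewrite (perm_mem (msuppMX _ _)); apply: contra ngm => /mapP[m' _ ->].
  exact: lem_addr.
move=> sp; apply/ideal_gen_cons.
exists (\sum_(m <- msupp p | (g <= m)%MM) p@_m *: 'X_[m - g]); apply/IHgs => m.
have -> : p - (\sum_(m <- msupp p | (g <= m)%MM) p@_m *: 'X_[m - g]) * 'X_[g] =
          \sum_(m <- msupp p | ~~ (g <= m)%MM) p@_m *: 'X_[m].
  rewrite {1}[p]mpolyE (bigID (fun m => g <= m)%MM) /= addrC mulr_suml.
  rewrite -[RHS]addr0 -addrA; congr (_ + _); apply/eqP; rewrite subr_eq0; apply/eqP.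
  by apply: eq_bigr => j gj; rewrite -scalerAl -mpolyXD submK.
rewrite mcoeff_msupp raddf_sum /= => nz.
have [mp gm] : m \in msupp p /\ ~~ (g <= m)%MM.
  apply/andP; apply: contraNT nz; rewrite negb_and => mpg.
  rewrite big_seq_cond big1 // => j /andP[jp gj]; rewrite mcoeffZ mcoeffX.
  case: (eqVneq j m) => [jm|_]; last by rewrite mulr0.
  by move: mpg; rewrite -jm jp gj.
by have := sp m mp; rewrite /= (negbTE gm).
Qed.

(** Multiplying by ['X_[h]] translates the support by [h], so an inclusion between a colon ideal and
    a monomial ideal reduces to divisibility of exponents. *)
Lemma monomial_ideal_colon h gs gs' p :
  (forall m, has (fun g => g <= h + m)%MM gs -> has (fun g => g <= m)%MM gs') ->
  p * 'X_[h] \in ideal_gen [seq 'X_[g] | g <- gs] ->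
  p \in ideal_gen [seq 'X_[g] | g <- gs'].
Proof.
move=> sub /monomial_idealP hp; apply/monomial_idealP => m mp; apply: sub.
by apply: hp; rewrite (perm_mem (msuppMX _ _)) map_f.
Qed.

Lemma lem_mulU (i : 'I_n) a m : (U_(i) *+ a <= m)%MM = (a <= m i)%N.
Proof.
apply/mnm_lepP/idP => [/(_ i)|am j]; rewrite mulmnE mnm1E; first by rewrite eqxx mul1n.
by case: eqVneq => [<-|//]; rewrite mul1n.
Qed.

(** The power of ['X_i] is a nonzerodivisor modulo that of ['X_j], which therefore divides [p]; then
    [q] is found by cancellation. *)
Lemma powersyz2 (i j : 'I_n) a b p q : i != j ->
  p * 'X_i ^+ a + q * 'X_j ^+ b = 0 ->
  exists s, p = s * 'X_j ^+ b /\ q = - (s * 'X_i ^+ a).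
Proof.
move=> ij e.
have : p * 'X_[U_(i) *+ a] \in ideal_gen [seq 'X_[g] | g <- [:: U_(j) *+ b]]%MM.
  apply/ideal_gen_cons; exists (- q); rewrite -!mpolyXn mulNr opprK e.
  by apply/ideal_genP; exists (fun=> 0); rewrite big_ord0.
move/(monomial_ideal_colon (gs' := [:: U_(j) *+ b]%MM)).
case/(_ _)/ideal_gen_cons => [m|s /ideal_gen_nil/eqP].
  by rewrite /= !orbF !lem_mulU mnmDE mulmnE mnm1E (negbTE ij).
rewrite subr_eq0 -mpolyXn => /eqP ps; exists s; split=> //.
have Xj0 : 'X_j ^+ b != 0 :> {mpoly k[n]}.
  by rewrite mpolyXn -msupp_eq0 msuppX.
apply/eqP; rewrite -addr_eq0 -(inj_eq (mulIf Xj0)) mul0r mulrDl.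
by rewrite addrC mulrAC -ps e.
Qed.

(** The power of ['X_l] is a nonzerodivisor modulo the other two, so [r] lies in the ideal they
    generate. Substituting this leaves a relation between two powers. *)
Lemma powersyz3 (i j l : 'I_n) a b c p q r : i != j -> i != l -> j != l ->
  p * 'X_i ^+ a + q * 'X_j ^+ b + r * 'X_l ^+ c = 0 ->
  exists s t u, [/\ p = s * 'X_j ^+ b - t * 'X_l ^+ c,
    q = - (s * 'X_i ^+ a) - u * 'X_l ^+ c & r = t * 'X_i ^+ a + u * 'X_j ^+ b].
Proof.
move=> ij il jl e.
have : r * 'X_[U_(l) *+ c] \in
    ideal_gen [seq 'X_[g] | g <- [:: U_(i) *+ a; U_(j) *+ b]]%MM.
  apply/ideal_gen_cons; exists (- p); apply/ideal_gen_cons; exists (- q).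
  rewrite -!mpolyXn !mulNr !opprK -addrA addrC -addrA [X in _ + X]addrC addrA.
  rewrite [X in X + _]addrC -addrA addrC e.
  by apply/ideal_genP; exists (fun=> 0); rewrite big_ord0.
move/(monomial_ideal_colon (gs' := [:: U_(i) *+ a; U_(j) *+ b]%MM)).
case/(_ _)/ideal_gen_cons => [m|t /ideal_gen_cons[u /ideal_gen_nil/eqP]].
  rewrite /= !orbF !lem_mulU !mnmDE !mulmnE !mnm1E.
  by rewrite [l == i]eq_sym [l == j]eq_sym (negbTE il) (negbTE jl).
rewrite -addrA -opprD subr_eq0 -!mpolyXn => /eqP rtu.
have /(powersyz2 ij)[s [ps qs]] :
    (p + t * 'X_l ^+ c) * 'X_i ^+ a + (q + u * 'X_l ^+ c) * 'X_j ^+ b = 0.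
  by rewrite -e rtu; ring.
by exists s, t, u; rewrite -ps -qs !addrK.
Qed.

End MonomialIdeals.

(** * Homogeneous matrices and matrices without constant terms *)

Section Grading.
Variables (n : nat) (k : fieldType).
Implicit Types (p q : {mpoly k[n]}) (d e : int).

Lemma homogz0 d : homogz d (0 : {mpoly k[n]}).
Proof. by case: d => d //=; apply: dhomog0. Qed.

Lemma homogzD d p q : homogz d p -> homogz d q -> homogz d (p + q).
Proof. by case: d => d /=; [apply: rpredD | move=> -> ->; rewrite addr0]. Qed.

Lemma homogzN d p : homogz d p -> homogz d (- p).
Proof. by case: d => d /=; [rewrite rpredN | move=> ->; rewrite oppr0]. Qed.

Lemma homogzM d e p q : homogz d p -> homogz e q -> homogz (d + e) (p * q).
Proof.
case: d => d /= hp; last by rewrite hp mul0r => _; apply: homogz0.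
case: e => e /= hq; last by rewrite hq mulr0; apply: homogz0.
exact: dhomogM.
Qed.

(** Entrywise criterion for [A] to be a degree 0 map between graded free modules with basis degrees
    [c] (source) and [b] (target). *)
Definition homog_mx r s (b : 'I_r -> int) (c : 'I_s -> int)
    (A : 'M[{mpoly k[n]}]_(r, s)) : Prop :=
  forall i j, homogz (c j - b i) (A i j).

Lemma homog_mx0 r s (b : 'I_r -> int) (c : 'I_s -> int) : homog_mx b c 0.
Proof. by move=> i j; rewrite mxE; apply: homogz0. Qed.

Lemma homog_mxN r s (b : 'I_r -> int) (c : 'I_s -> int) A :
  homog_mx b c A -> homog_mx b c (- A).
Proof. by move=> hA i j; rewrite mxE; apply/homogzN/hA. Qed.

Lemma homog_mx_tr r s (b : 'I_r -> int) (c : 'I_s -> int) (e : int) A :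
  homog_mx b c A -> homog_mx (fun j => e - c j) (fun i => e - b i) A^T.
Proof.
move=> hA i j; rewrite mxE; have -> : e - b j - (e - c i) = c i - b j by ring.
exact: hA.
Qed.

Definition split_fun (T : Type) r s (f : 'I_r -> T) (g : 'I_s -> T)
    (i : 'I_(r + s)) : T :=
  match split i with inl j => f j | inr j => g j end.

Lemma homog_block_mx r1 r2 s1 s2 (b1 : 'I_r1 -> int) (b2 : 'I_r2 -> int)
    (c1 : 'I_s1 -> int) (c2 : 'I_s2 -> int) A B C D :
  homog_mx b1 c1 A -> homog_mx b1 c2 B -> homog_mx b2 c1 C -> homog_mx b2 c2 D ->
  homog_mx (split_fun b1 b2) (split_fun c1 c2) (block_mx A B C D).
Proof.
move=> hA hB hC hD i j; rewrite !mxE /split_fun.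
by case: (split i) => i'; rewrite !mxE; case: (split j) => j'.
Qed.

Lemma free_homog_mulmx r s (b : 'I_r -> int) (c : 'I_s -> int) A d v :
  homog_mx b c A -> free_homog c d v -> free_homog b d (A *m v).
Proof.
move=> hA hv i; rewrite mxE.
apply: (big_ind (homogz (d - b i))) => [|p q|j _].
- exact: homogz0.
- exact: homogzD.
have -> : d - b i = (c j - b i) + (d - c j) by ring.
exact: homogzM.
Qed.

Definition const_free r s (A : 'M[{mpoly k[n]}]_(r, s)) : Prop :=
  forall i j, (A i j)@_0 = 0.

(** The irrelevant ideal is the monomial ideal with exponents [U_(i)], and every nonzero exponent
    dominates one of these. *)
Lemma mem_irrelevant_ideal p : p@_0 = 0 -> p \in @irrelevant_ideal n k.
Proof.
move=> p0; rewrite /irrelevant_ideal (_ : map _ _ =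
  [seq 'X_[g] | g <- [seq U_(i)%MM | i <- enum 'I_n]]); last by rewrite -map_comp.
apply/monomial_idealP => m mp; rewrite has_map.
have : m != 0%MM by apply: contraTneq mp => ->; rewrite mcoeff_msupp p0 eqxx.
apply: contraNT => /hasPn hm; apply/eqP/mnmP => i; rewrite mnm0E.
by have := hm i (mem_enum _ _); rewrite /= lep1mP negbK => /eqP.
Qed.

Lemma const_free_mulmx r s (A : 'M[{mpoly k[n]}]_(r, s)) (v : 'cV_s) i :
  const_free A -> (A *m v) i 0 \in @irrelevant_ideal n k.
Proof.
move=> hA; apply: mem_irrelevant_ideal.
rewrite mxE raddf_sum /= big1 // => j _.
by rewrite (rmorphM (mcoeff 0%MM)) /= hA mul0r.
Qed.

Lemma const_free0 r s : const_free (0 : 'M_(r, s)).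
Proof. by move=> i j; rewrite mxE mcoeff0. Qed.

Lemma const_freeN r s (A : 'M_(r, s)) : const_free A -> const_free (- A).
Proof. by move=> hA i j; rewrite mxE mcoeffN hA oppr0. Qed.

Lemma const_free_tr r s (A : 'M_(r, s)) : const_free A -> const_free A^T.
Proof. by move=> hA i j; rewrite mxE. Qed.

Lemma const_free_block_mx r1 r2 s1 s2 (A : 'M_(r1, s1)) (B : 'M_(r1, s2))
    (C : 'M_(r2, s1)) (D : 'M_(r2, s2)) :
  const_free A -> const_free B -> const_free C -> const_free D ->
  const_free (block_mx A B C D).
Proof.
move=> hA hB hC hD i j; rewrite !mxE.
by case: (split i) => i'; rewrite !mxE; case: (split j).
Qed.

End Grading.

(** * Matrices given by lists of rows *)

Lemma eq_mulmx_col (R : nzRingType) m n (A B : 'M[R]_(m, n)) :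
  (forall v : 'cV_n, A *m v = B *m v) -> A = B.
Proof.
move=> e; apply/matrixP => i j.
by have /colP/(_ i) := e (delta_mx j 0); rewrite -!colE !mxE.
Qed.

Section RowLists.
Variable k : fieldType.
Local Notation P := {mpoly k[4]}.
Implicit Types (r s t : seq P) (rs : seq (seq P)).

(** Recursion on lists lets [/=] unfold a product with a column into explicit polynomials. *)
Fixpoint dotp r s : P :=
  match r, s with a :: r', b :: s' => a * b + dotp r' s' | _, _ => 0 end.

Lemma dotpE r s : dotp r s = \sum_(j < size s) r`_j * s`_j.
Proof.
elim: s r => [|b s IHs] [|a r] /=; rewrite ?big_ord0 //.
  by rewrite big1 // => j _; rewrite nth_nil mul0r.
by rewrite big_ord_recl /= IHs.
Qed.

Lemma mulmx_of_rows m n rs s : size s = n ->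
  mx_of_rows m n rs *m \col_j s`_j = \col_i [seq dotp r s | r <- rs]`_i.
Proof.
move=> <-; apply/matrixP => i j; rewrite !mxE.
(* Past the end of [rs] the row defaults to the empty list, whose [dotp] is 0, in agreement with the
   default entry on the left. *)
have -> : [seq dotp r s | r <- rs]`_i = dotp (nth [::] rs i) s.
  have [lt|ge] := ltnP i (size rs); first by rewrite (nth_map [::]).
  by rewrite !nth_default ?size_map.
by rewrite dotpE; apply: eq_bigr => l _; rewrite !mxE.
Qed.

Lemma col_of_seq m (v : 'cV[P]_m) : exists2 s, size s = m & v = \col_i s`_i.
Proof.
exists [seq v i 0 | i <- enum 'I_m]; first by rewrite size_map size_enum_ord.
apply/colP => i; rewrite mxE (nth_map i) ?size_enum_ord //.
by rewrite nth_ord_enum.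
Qed.

Lemma col_empty m (v : 'cV[P]_m) : m = 0%N -> v = 0.
Proof. by move=> m0; subst m; apply: flatmx0. Qed.

Lemma col_of_seq_eq0 m s : size s = m -> \col_(i < m) s`_i = 0 -> forall i, s`_i = 0.
Proof.
move=> ss e i; have [im|] := ltnP i m; last by rewrite -ss => /(nth_default 0).
by have /colP/(_ (Ordinal im)) := e; rewrite !mxE.
Qed.

Lemma col_of_seq_congr m s t : s = t -> \col_(i < m) s`_i = \col_(i < m) t`_i.
Proof. by move=> ->. Qed.

End RowLists.

Local Ltac solve_col :=
  rewrite mulmx_of_rows //; apply: col_of_seq_congr => /=;
  repeat match goal with |- _ :: _ = _ :: _ => congr (_ :: _) end.

(** * Characteristic two and the transposed matrices *)

Section Resolution.
Variable k : fieldType.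
Hypothesis char2 : 2%N \in [pchar k].
Local Notation P := {mpoly k[4]}.
Local Notation o i := (@Ordinal 4 i isT).
Local Notation X i := ('X_(o i) : P).
Local Notation x := (X 0).
Local Notation y := (X 1).
Local Notation z := (X 2).
Local Notation w := (X 3).

(** Handed to [ring] as a rewriting equation, so that identities are decided modulo 2. *)
Let c2 : 2%:R = 0 :> P.
Proof. by rewrite -mpolyC_nat (pcharf0 char2). Qed.

Lemma oppr_char2 (p : P) : - p = p.
Proof. by apply/eqP; rewrite eq_sym -addr_eq0 -mulr2n -mulr_natl c2 mul0r. Qed.

Lemma tr_K1 : (K1 k)^T = mx_of_rows 5 1
  [:: [:: y ^+ 2]; [:: z ^+ 2]; [:: x * y]; [:: x * z]; [:: x * w]].
Proof. by apply/matrixP => -[[|[|[|[|[|//]]]]] ?] [[|//] ?]; rewrite !mxE. Qed.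

Lemma tr_K2 : (K2 k)^T = mx_of_rows 6 5
  [:: [:: z ^+ 2; y ^+ 2; 0; 0; 0];
      [:: 0; x; 0; z; 0];
      [:: x; 0; y; 0; 0];
      [:: 0; 0; 0; w; z];
      [:: 0; 0; w; 0; y];
      [:: 0; 0; z; y; 0]].
Proof.
by apply/matrixP => -[[|[|[|[|[|[|//]]]]]] ?] [[|[|[|[|[|//]]]]] ?]; rewrite !mxE.
Qed.

Lemma tr_K3 : (K3 k)^T = mx_of_rows 2 6
  [:: [:: x; y ^+ 2; z ^+ 2; 0; 0; y * z]; [:: 0; 0; 0; y; z; w]].
Proof. by apply/matrixP => -[[|[|//]] ?] [[|[|[|[|[|[|//]]]]]] ?]; rewrite !mxE. Qed.

Lemma mpolyX_mulI (i : 'I_4) (p : P) : 'X_i * p = 0 -> p = 0.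
Proof.
move/eqP; rewrite mulf_eq0 => /orP[|/eqP//].
by rewrite -msupp_eq0 msuppX.
Qed.

Lemma addr_eq0_char2 (p q : P) : (p + q == 0) = (p == q).
Proof. by rewrite addr_eq0 oppr_char2. Qed.

Lemma powersyz2_char2 (i j : 'I_4) a b (p q : P) : i != j ->
  p * 'X_i ^+ a + q * 'X_j ^+ b = 0 ->
  exists s, p = s * 'X_j ^+ b /\ q = s * 'X_i ^+ a.
Proof. by move=> ij /(powersyz2 ij)[s]; rewrite oppr_char2; exists s. Qed.

Lemma powersyz3_char2 (i j l : 'I_4) a b c (p q r : P) :
  i != j -> i != l -> j != l ->
  p * 'X_i ^+ a + q * 'X_j ^+ b + r * 'X_l ^+ c = 0 ->
  exists s t u, [/\ p = s * 'X_j ^+ b + t * 'X_l ^+ c,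
    q = s * 'X_i ^+ a + u * 'X_l ^+ c & r = t * 'X_i ^+ a + u * 'X_j ^+ b].
Proof.
move=> ij il jl /(powersyz3 ij il jl)[s [t [u]]].
by rewrite !oppr_char2; exists s, t, u.
Qed.

(** * Kernels of the matrices and injectivity on H_0 *)

Lemma ker_K1 (v : 'cV_5) : K1 k *m v = 0 -> exists u, v = K2 k *m u.
Proof.
have [[|a[|b[|c[|d[|e[|//]]]]]] // _ ->] := col_of_seq v.
rewrite mulmx_of_rows // => /col_of_seq_eq0 -/(_ erefl) h; move: (h 0) => /= {}h.
(* The terms in xy, xz, xw are grouped as a multiple of x, giving a relation between y^2, z^2 and
   x. *)
have [] := @powersyz3_char2 (o 1) (o 2) (o 0)
  2 2 1 a b (y * c + z * d + w * e) isT isT isT.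
  by rewrite -h; ring.
move=> s [t [u [-> -> /eqP]]]; rewrite -addr_eq0_char2 => /eqP h2.
(* The coefficient of x now equals t y^2 + u z^2, which is a relation between y, z and w. *)
have [] := @powersyz3_char2 (o 1) (o 2) (o 3)
  1 1 1 (c + t * y) (d + u * z) e isT isT isT.
  by rewrite -h2; ring.
move=> s' [t' [u' [/eqP + /eqP + ->]]].
(* Carries [t * y] to the other side to solve for [c]; the next line does the same for [d]. *)
rewrite -addr_eq0_char2 -addrA addr_eq0_char2 => /eqP ->.
rewrite -addr_eq0_char2 -addrA addr_eq0_char2 => /eqP ->.
exists (\col_i [:: s; u; t; u'; t'; s']`_i).
by solve_col; ring: c2.
Qed.

Lemma mpolyX_mul_add (i : 'I_4) (p q : P) : 'X_i * (p + q) = 0 -> q = p.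
Proof. by move=> /mpolyX_mulI/eqP; rewrite addr_eq0_char2 => /eqP. Qed.

(** Counting rows from 0, rows 0 and 4 are two-term relations, parametrised by [s] and [t]; rows 1
    and 2 then determine [b] and [f] after cancelling x and z. *)
Lemma ker_K2 (v : 'cV_6) : K2 k *m v = 0 -> exists u, v = K3 k *m u.
Proof.
have [[|a[|b[|c[|d[|e[|f[|//]]]]]]] // _ ->] := col_of_seq v.
rewrite mulmx_of_rows // => /col_of_seq_eq0 -/(_ erefl) h.
move: (h 0) (h 1) (h 2) (h 4) => /= {h}h0 h1 h2 h4.
have [] := @powersyz2_char2 (o 2) (o 0) 2 1 a c isT; first by rewrite -h0; ring.
move=> s [as_ cs]; subst a c.
have bs : b = s * y ^+ 2 by apply: (@mpolyX_mul_add (o 0)); rewrite -h1; ring.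
subst b.
have [] := @powersyz2_char2 (o 2) (o 1) 1 1 d e isT; first by rewrite -h4; ring.
move=> t [dt et]; subst d e.
have -> : f = s * y * z + t * w by apply: (@mpolyX_mul_add (o 2)); rewrite -h2; ring.
by exists (\col_i [:: s; t]`_i); solve_col; ring: c2.
Qed.

Lemma ker_K3 (v : 'cV_2) : K3 k *m v = 0 -> v = 0.
Proof.
have [[|a[|b[|//]]] // _ ->] := col_of_seq v.
rewrite mulmx_of_rows // => /col_of_seq_eq0 -/(_ erefl) h.
have -> : a = 0 by apply: (@mpolyX_mulI (o 0)); rewrite -(h 0) /=; ring.
have -> : b = 0 by apply: (@mpolyX_mulI (o 1)); rewrite -(h 3) /=; ring.
by apply/colP => -[[|[|//]] ?]; rewrite !mxE.
Qed.

Lemma ker_tr_K1 (v : 'cV_1) : (K1 k)^T *m v = 0 -> v = 0.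
Proof.
rewrite tr_K1; have [[|a[|//]] // _ ->] := col_of_seq v.
rewrite mulmx_of_rows // => /col_of_seq_eq0 -/(_ erefl) h.
have -> : a = 0.
  by apply: (@mpolyX_mulI (o 1)); apply: (@mpolyX_mulI (o 1)); rewrite -(h 0) /=; ring.
by apply/colP => -[[|//] ?]; rewrite !mxE.
Qed.

(** Row 5 gives (c, d) = s (y, z). Row 2 becomes a relation between x and y^2, forcing s = t x; rows
    1 and 3 then yield [b] and [e] by cancellation. *)
Lemma ker_tr_K2 (v : 'cV_5) : (K2 k)^T *m v = 0 -> exists u, v = (K1 k)^T *m u.
Proof.
rewrite tr_K1 tr_K2; have [[|a[|b[|c[|d[|e[|//]]]]]] // _ ->] := col_of_seq v.
rewrite mulmx_of_rows // => /col_of_seq_eq0 -/(_ erefl) h.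
move: (h 1) (h 2) (h 3) (h 5) => /= {h}h1 h2 h3 h5.
have [] := @powersyz2_char2 (o 2) (o 1) 1 1 c d isT; first by rewrite -h5; ring.
move=> s [cs ds]; subst c d.
have [] := @powersyz2_char2 (o 0) (o 1) 1 2 a s isT; first by rewrite -h2; ring.
move=> t [at_ st]; subst a s.
have -> : b = t * z ^+ 2 by apply: (@mpolyX_mul_add (o 0)); rewrite -h1; ring.
have -> : e = t * x * w by apply: (@mpolyX_mul_add (o 2)); rewrite -h3; ring.
by exists (\col_i [:: t]`_i); solve_col; ring: c2.
Qed.

Lemma ker_tr_K3 (v : 'cV_6) : (K3 k)^T *m v = 0 -> exists u, v = (K2 k)^T *m u.
Proof.
rewrite tr_K2 tr_K3; have [[|a[|b[|c[|d[|e[|f[|//]]]]]]] // _ ->] := col_of_seq v.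
rewrite mulmx_of_rows // => /col_of_seq_eq0 -/(_ erefl) h.
move: (h 0) (h 1) => /= {h}h0 h1.
have [] := @powersyz3_char2 (o 1) (o 2) (o 3) 1 1 1 d e f isT isT isT.
  by rewrite -h1; ring.
move=> s [t [u [ds es fs]]]; subst d e f.
(* With f = t y + u z, the term y z f splits into multiples of y^2 and z^2, which join those of [b]
   and [c]. *)
have [] := @powersyz3_char2 (o 1) (o 2) (o 0) 2 2 1 (b + z * t) (c + y * u) a isT isT isT.
  by rewrite -h0; ring.
move=> s' [t' [u' [/eqP + /eqP + ->]]].
rewrite -addr_eq0_char2 -addrA addr_eq0_char2 => /eqP ->.
rewrite -addr_eq0_char2 -addrA addr_eq0_char2 => /eqP ->.
(* The [s'] terms supply the multiples of z^2 in [b] and of y^2 in [c]; in the last three rows they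
   occur twice and cancel modulo 2. *)
exists (\col_i [:: u'; t'; u + s' * y; t + s' * z; s + s' * w]`_i).
by solve_col; ring: c2.
Qed.

(** All of J lies in (y, z, w), so x^3 b does too, whence b = b1 y + b2 z + b3 w. Working modulo
    (y^2, z^2, x) then determines [a], and the six coefficients form the preimage under the
    transpose of [K3]. *)
Lemma inj_L0 (c : 'cV_2) (u : 'cV_5) :
  L0 k *m c = K1 k *m u -> exists v, c = (K3 k)^T *m v.
Proof.
rewrite tr_K3; have [[|a[|b[|//]]] // _ ->] := col_of_seq c.
have [[|u1[|u2[|u3[|u4[|u5[|//]]]]]] // _ ->] := col_of_seq u.
rewrite !mulmx_of_rows // => /colP/(_ 0); rewrite !mxE /= => h.
have : b * 'X_[U_(o 0) *+ 3] \in
    ideal_gen [seq 'X_[g] | g <- [:: U_(o 1); U_(o 2); U_(o 3)]]%MM.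
  apply/ideal_gen_cons; exists (y * u1 + x * u3 + z * w * b).
  apply/ideal_gen_cons; exists (z * u2 + x * u4).
  apply/ideal_gen_cons; exists (x * u5 + w * a).
  apply/ideal_genP; exists (fun=> 0); rewrite big_ord0 -!mpolyXn !oppr_char2.
  transitivity ((w ^+ 2 * a + ((x ^+ 3 + y * z * w) * b + 0)) +
    (y ^+ 2 * u1 + (z ^+ 2 * u2 + (x * y * u3 + (x * z * u4 + (x * w * u5 + 0)))))).
    by ring.
  by rewrite h; ring: c2.
move/(monomial_ideal_colon (gs' := [:: U_(o 1) *+ 1; U_(o 2) *+ 1; U_(o 3) *+ 1]%MM)).
case/(_ _)/ideal_gen_cons => [m|b1].
  by rewrite /= !lep1mP ?lem_mulU !mnmDE ?mulmnE !mnm1E.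
case/ideal_gen_cons => b2 /ideal_gen_cons[b3] /ideal_gen_nil/eqP.
rewrite -!mpolyXn !oppr_char2 -!addrA addr_eq0_char2 => /eqP bE; subst b.
(* In y z w b the contributions of [b1] and [b2] are multiples of y^2 and z^2, while that of [b3] is
   y z w^2 b3, absorbed into the coefficient of w^2. *)
have : (a + b3 * y * z) * 'X_[U_(o 3) *+ 2] \in
    ideal_gen [seq 'X_[g] | g <- [:: U_(o 1) *+ 2; U_(o 2) *+ 2; U_(o 0) *+ 1]]%MM.
  apply/ideal_gen_cons; exists (z * w * b1 + u1).
  apply/ideal_gen_cons; exists (y * w * b2 + u2).
  apply/ideal_gen_cons.
  exists (x ^+ 2 * (b1 * y + b2 * z + b3 * w) + y * u3 + z * u4 + w * u5).
  apply/ideal_genP; exists (fun=> 0); rewrite big_ord0 -!mpolyXn !oppr_char2.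
  move/eqP: h; rewrite -addr_eq0_char2 => /eqP h.
  by rewrite -h; ring: c2.
move/(monomial_ideal_colon (gs' := [:: U_(o 1) *+ 2; U_(o 2) *+ 2; U_(o 0) *+ 1]%MM)).
case/(_ _)/ideal_gen_cons => [m|a1].
  by rewrite /= !lep1mP ?lem_mulU !mnmDE ?mulmnE !mnm1E.
case/ideal_gen_cons => a2 /ideal_gen_cons[a3] /ideal_gen_nil/eqP.
rewrite -!mpolyXn !oppr_char2 -!addrA addr_eq0_char2 => /eqP ->.
exists (\col_i [:: a3; a1; a2; b1; b2; b3]`_i).
by solve_col; ring: c2.
Qed.

(** * Degrees and minimality *)

Definition bot_deg (i : nat) (j : 'I_(rk (botC k) i)) : int :=
  nth 0%N (nth [::] [:: [:: 0]; [:: 2; 2; 2; 2; 2]; [:: 4; 3; 3; 3; 3; 3]; [:: 5; 4]] i)%N j.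

(* Dualising negates degrees; the shift by 7 makes the vertical maps homogeneous of degree 0. *)
Definition top_deg (i : nat) : 'I_(rk (topC k) i) -> int :=
  match i with
  | 0 => fun j => 7 - bot_deg (i := 3) j
  | 1 => fun j => 7 - bot_deg (i := 2) j
  | 2 => fun j => 7 - bot_deg (i := 1) j
  | 3 => fun j => 7 - bot_deg (i := 0) j
  | _ => fun=> 0
  end.

Local Ltac solve_homog :=
  rewrite !mxE /=;
  first [exact: dhomog0 | exact: homogz0 | done
  | rewrite ?rpredD // ?mpolyXn -?mpolyXD dhomogX /= ?(mdegD, mdegMn, mdeg1) //].

(** The degrees accumulate along columns: [K1] consists of quadrics, the first column of [K2] adds 2
    and the others 1, and [K3] maps generators of degrees 5 and 4. *)
Lemma homog_bot i : homog_mx (@bot_deg i) (@bot_deg i.+1) (diff (botC k) i).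
Proof.
case: i => [|[|[|i]]] /=; last exact: homog_mx0.
- by move=> [[|//] ?] [[|[|[|[|[|//]]]]] ?]; solve_homog.
- by move=> [[|[|[|[|[|//]]]]] ?] [[|[|[|[|[|[|//]]]]]] ?]; solve_homog.
- by move=> [[|[|[|[|[|[|//]]]]]] ?] [[|[|//]] ?]; solve_homog.
Qed.

Lemma homog_top i : homog_mx (@top_deg i) (@top_deg i.+1) (diff (topC k) i).
Proof.
case: i => [|[|[|i]]]; last exact: homog_mx0.
- exact: (homog_mx_tr 7 (@homog_bot 2)).
- exact: (homog_mx_tr 7 (@homog_bot 1)).
- exact: (homog_mx_tr 7 (@homog_bot 0)).
Qed.

Lemma homog_vert i : homog_mx (@bot_deg i) (@top_deg i) (vertL k i).
Proof.
case: i => [|[|[|[|i]]]] /=; last exact: homog_mx0.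
- by move=> [[|//] ?] [[|[|//]] ?]; solve_homog.
- by move=> [[|[|[|[|[|//]]]]] ?] [[|[|[|[|[|[|//]]]]]] ?]; solve_homog.
- by move=> [[|[|[|[|[|[|//]]]]]] ?] [[|[|[|[|[|//]]]]] ?]; solve_homog.
- by move=> [[|[|//]] ?] [[|//] ?]; solve_homog.
Qed.

Local Ltac solve_const_free :=
  rewrite !mxE /= ?mcoeff0 //= ?mcoeffD ?mpolyXn -?mpolyXD !mcoeffX -!mdeg_eq0
    ?(mdegD, mdegMn, mdeg1) ?addr0 //.

Lemma const_free_bot i : const_free (diff (botC k) i).
Proof.
case: i => [|[|[|i]]] /=; last exact: const_free0.
- by move=> [[|//] ?] [[|[|[|[|[|//]]]]] ?]; solve_const_free.
- by move=> [[|[|[|[|[|//]]]]] ?] [[|[|[|[|[|[|//]]]]]] ?]; solve_const_free.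
- by move=> [[|[|[|[|[|[|//]]]]]] ?] [[|[|//]] ?]; solve_const_free.
Qed.

Lemma const_free_top i : const_free (diff (topC k) i).
Proof.
case: i => [|[|[|i]]]; last exact: const_free0.
- exact: const_free_tr (@const_free_bot 2).
- exact: const_free_tr (@const_free_bot 1).
- exact: const_free_tr (@const_free_bot 0).
Qed.

Lemma const_free_L0 : const_free (L0 k).
Proof. by move=> [[|//] ?] [[|[|//]] ?]; solve_const_free. Qed.

Lemma const_free_L1 : const_free (L1 k).
Proof. by move=> [[|[|[|[|[|//]]]]] ?] [[|[|[|[|[|[|//]]]]]] ?]; solve_const_free. Qed.

Lemma const_free_vert i : const_free (vertL k i).
Proof.
case: i => [|[|[|[|i]]]]; last exact: const_free0.
- exact: const_free_L0.
- exact: const_free_L1.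
- exact: const_free_tr (@const_free_L1).
- exact: const_free_tr (@const_free_L0).
Qed.

Definition cone_deg (i : nat) : 'I_(rk (mapping_cone (vertL k)) i) -> int :=
  split_fun
    (match i return 'I_(shift_rk (topC k) i) -> int with
     | 0 => fun=> 0 | j.+1 => @top_deg j end)
    (@bot_deg i).

Lemma homog_cone i :
  homog_mx (@cone_deg i) (@cone_deg i.+1) (diff (mapping_cone (vertL k)) i).
Proof.
apply: homog_block_mx; first 1 last.
- exact: homog_mx0.
- exact: homog_vert.
- exact: homog_bot.
by case: i => [|i]; apply: homog_mxN; [exact: homog_mx0 | exact: homog_top].
Qed.

Lemma minimal_cone : minimal_complex (mapping_cone (vertL k)).
Proof.
move=> i v j; apply: const_free_mulmx; apply: const_free_block_mx.
- by case: i v j => [|i] _ _; apply: const_freeN; [exact: const_free0 | exact: const_free_top].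
- exact: const_free0.
- exact: const_free_vert.
- exact: const_free_bot.
Qed.

(** * The two complexes and the commuting squares *)

Lemma mul_K1_K2 : K1 k *m K2 k = 0.
Proof.
by apply/matrixP => -[[|//] ?] [[|[|[|[|[|[|//]]]]]] ?];
  rewrite !mxE !big_ord_recl big_ord0 !mxE /=; ring: c2.
Qed.

Lemma mul_K2_K3 : K2 k *m K3 k = 0.
Proof.
by apply/matrixP => -[[|[|[|[|[|//]]]]] ?] [[|[|//]] ?];
  rewrite !mxE !big_ord_recl big_ord0 !mxE /=; ring: c2.
Qed.

Lemma mul_L0_trK3 : L0 k *m (K3 k)^T = K1 k *m L1 k.
Proof.
by apply/matrixP => -[[|//] ?] [[|[|[|[|[|[|//]]]]]] ?];
  rewrite !mxE !big_ord_recl !big_ord0 !mxE /=; ring: c2.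
Qed.

Lemma tr_L1 : (L1 k)^T = mx_of_rows 6 5
  [:: [:: 0; 0; 0; 0; w];
      [:: w ^+ 2; 0; 0; 0; 0];
      [:: 0; w ^+ 2; 0; 0; 0];
      [:: z * w; 0; x ^+ 2; 0; 0];
      [:: 0; y * w; 0; x ^+ 2; 0];
      [:: 0; 0; 0; 0; x ^+ 2]].
Proof.
by apply/matrixP => -[[|[|[|[|[|[|//]]]]]] ?] [[|[|[|[|[|//]]]]] ?]; rewrite !mxE.
Qed.

(** The middle square states that [L1] times the transpose of [K2] is symmetric. Testing on a column
    with arbitrary entries gives one polynomial identity per row. *)
Lemma mul_L1_trK2 : L1 k *m (K2 k)^T = K2 k *m (L1 k)^T.
Proof.
apply: eq_mulmx_col => v; rewrite -!mulmxA tr_K2 tr_L1.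
(* A [//] here would try to decide the polynomial identity by conversion. *)
have [s sz ->] := col_of_seq v.
case: s sz => [|a[|b[|c[|d[|e[|f s]]]]]] sz; try discriminate sz.
do 4![rewrite mulmx_of_rows; last by []].
apply: col_of_seq_congr; rewrite [map _ _]/= [RHS]/=.
by do 5?[congr (_ :: _); first by ring: c2].
Qed.

Lemma bot_complex : is_complex (botC k).
Proof.
case=> [|[|i]] /=; [exact: mul_K1_K2 | exact: mul_K2_K3 |].
by rewrite mulmx0.
Qed.

Lemma top_complex : is_complex (topC k).
Proof.
case=> [|[|i]] /=; last by rewrite mulmx0.
- by rewrite -trmx_mul mul_K2_K3 trmx0.
- by rewrite -trmx_mul mul_K1_K2 trmx0.
Qed.

(** The diagram is self-dual: the square in degree 2 is the transpose of the one in degree 0. *)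
Lemma vert_complex_map : is_complex_map (vertL k).
Proof.
case=> [|[|[|i]]] /=; [exact: mul_L0_trK3 | exact: mul_L1_trK2 | |].
- by apply: trmx_inj; rewrite !trmx_mul !trmxK mul_L0_trK3.
- by rewrite mul0mx mulmx0.
Qed.

(** * Exactness of the cone and the augmentation *)

Lemma bot_acyclic : acyclic (botC k).
Proof.
case=> [|[|[|i]]] v /=; [exact: ker_K1 | exact: ker_K2 | |] => e; exists 0.
- by rewrite mulmx0; apply: ker_K3.
(* The rank is here the default 0 of [nth], exposed by the case split on [i]. *)
- by rewrite mulmx0; apply: col_empty; case: i {v e}.
Qed.

Lemma top_acyclic : acyclic (topC k).
Proof.
case=> [|[|[|i]]] v /=; [exact: ker_tr_K3 | exact: ker_tr_K2 | |] => e; exists 0.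
- by rewrite mulmx0; apply: ker_tr_K1.
- by rewrite mulmx0; apply: col_empty; case: i {v e}.
Qed.

Lemma cone_acyclic : acyclic (mapping_cone (vertL k)).
Proof.
apply: mapping_cone_acyclic vert_complex_map top_acyclic bot_acyclic _.
exact: inj_L0.
Qed.

Lemma piA_eq0 (p : P) : piA p = 0 <-> p \in @idealA k.
Proof.
have pi0 : piA (0 : P) = 0 by rewrite /piA rmorph0.
rewrite -{2}[p]subr0 Quotient.idealrBE -pi0.
by split=> [h|/eqP h]; [apply/eqP|].
Qed.

(** The generators of the ideal are the entries of [L0] and [K1] in another order, so the ideal is
    the image of the last differential of the cone. *)
Lemma idealA_image (p : P) :
  p \in @idealA k <->
  exists (u : 'cV_2) (v : 'cV_5), p = (L0 k *m u + K1 k *m v) 0 0.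
Proof.
split=> [|[u [v ->]]].
  move=> /ideal_gen_cons[a] /ideal_gen_cons[b] /ideal_gen_cons[c].
  move=> /ideal_gen_cons[d] /ideal_gen_cons[e] /ideal_gen_cons[f].
  move=> /ideal_gen_cons[g] /ideal_gen_nil/eqP h.
  exists (\col_i [:: f; g]`_i), (\col_i [:: d; e; a; b; c]`_i).
  rewrite !mulmx_of_rows // !mxE /=; apply/eqP; rewrite -subr_eq0; apply/eqP.
  by apply: etrans (eqP h); ring.
have [[|f[|g[|//]]] // _ ->] := col_of_seq u.
have [[|d[|e[|a[|b[|c[|//]]]]]] // _ ->] := col_of_seq v.
apply/ideal_gen_cons; exists a; apply/ideal_gen_cons; exists b.
apply/ideal_gen_cons; exists c; apply/ideal_gen_cons; exists d.
apply/ideal_gen_cons; exists e; apply/ideal_gen_cons; exists f.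
apply/ideal_gen_cons; exists g; apply/ideal_genP; exists (fun=> 0).
by rewrite big_ord0 !mulmx_of_rows // !mxE /=; ring.
Qed.

(** The cone has rank [0 + 1] in degree 0, which computes to 1, so this serves directly as its
    augmentation. *)
Definition aug (v : 'cV[P]_1) : algA k := piA (v 0 0).

Lemma aug_linear : linear aug.
Proof. by move=> p u v; rewrite /aug /piA !mxE rmorphD rmorphM. Qed.

HB.instance Definition _ :=
  GRing.isLinear.Build P 'cV[P]_1 (algA k) *:%R aug aug_linear.

Lemma aug_exact (v : 'cV[P]_1) :
  aug v = 0 <-> exists u, v = diff (mapping_cone (vertL k)) 0 *m u.
Proof.
(* The upper blocks of this differential have no rows. *)
have E (u1 : 'cV_2) (u2 : 'cV_5) : diff (mapping_cone (vertL k)) 0 *m col_mx u1 u2 =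
    L0 k *m u1 + K1 k *m u2.
  apply/colP => i; rewrite /= mul_block_col [LHS]mxE.
  by case: splitP => [[]//|j _]; rewrite [i]ord1 [j]ord1.
rewrite /aug piA_eq0 idealA_image; split=> [[u1 [u2 h]]|[u vu]].
  by exists (col_mx u1 u2); apply/colP => i; rewrite [i]ord1 h -E.
exists (usubmx (u : 'cV_(2 + 5))), (dsubmx (u : 'cV_(2 + 5))).
by rewrite -E vsubmxK vu.
Qed.

Lemma cone_resolution :
  homogeneous_resolution (@degA k) (mapping_cone (vertL k)).
Proof.
exists @cone_deg, aug; split; split.
- exact: mapping_cone_complex top_complex bot_complex vert_complex_map.
- exact: cone_acyclic.
- move=> a; exists (const_mx (repr a)).
  by rewrite /= /aug mxE /piA reprK.
- exact: aug_exact.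
- by move=> i d v; apply: free_homog_mulmx; apply: homog_cone.
- move=> d v /(_ 0) h; exists (v 0 0) => //; move: h; rewrite /cone_deg /split_fun.
  by case: splitP => [[]//|j _]; rewrite [j]ord1 /bot_deg /= subr0.
Qed.

End Resolution.

Theorem mainTheorem5 (k : fieldType) (char2 : 2%N \in [pchar k]) :
  [/\ is_complex (topC k),
      is_complex (botC k),
      is_complex_map (vertL k)
    & minimal_homogeneous_resolution (@degA k) (mapping_cone (vertL k))].
Proof.
split; [exact: top_complex | exact: bot_complex | exact: vert_complex_map |].
by split; [exact: cone_resolution | exact: minimal_cone].
Qed.
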